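(* Let $D$ be an integral domain with fraction field $k$. Let $(T,M)$ be a local domain with residue field $k = T/M$, let $\pi : T \twoheadrightarrow k$ be the canonical surjection, and let $D \times_k T = \{t \in T \mid \pi(t) \in D\}$. If $D \times_k T$ has the property that every flat overring of $D \times_k T$ is a localization of $D \times_k T$, then every flat overring of $D$ is a localization of $D$. The converse holds if $T$ is a valuation domain: in that case, if every flat overring of $D$ is a localization of $D$, then every flat overring of $D \times_k T$ is a localization of $D \times_k T$.
   Context: All rings are commutative with $1$. A local domain $(T,M)$ is an integral domain $T$ with unique maximal ideal $M$ (no Noetherian assumption). An overring of an integral domain $R$ is a ring $S$ with $R \subseteq S \subseteq \operatorname{Frac}(R)$. An overring $S$ of $R$ is flat if it is flat as an $R$-module. A localization of $R$ is an overring of the form $R_W$ for a multiplicative subset $W$ of $R$ with $0 \notin W$. *)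

(* Defs.v *)
From HB Require Import structures.
From mathcomp Require Import all_boot all_algebra.
From mathcomp Require Import boolp.

Set Implicit Arguments.
Unset Strict Implicit.
Unset Printing Implicit Defensive.

Import GRing.Theory.
Local Open Scope ring_scope.

Notation "x %:F" := (tofrac x) : ring_scope.

Section Flatness.
Variable R : comNzRingType.

(* A list [:: (n1, a1); ...; (nr, ar)] stands for the formal sum
   n1 (x) a1 + ... + nr (x) ar, and [tensor_eq] is equality of such sums in the
   tensor product of N and A over R: the quotient of the free commutative monoid
   on N * A by the congruence generated by the bilinearity relations. This
   quotient is already a group, - (n (x) a) being (- n) (x) a. *)
Inductive tensor_eq (N A : lmodType R) : seq (N * A) -> seq (N * A) -> Prop :=
| tensor_refl u : tensor_eq u u
| tensor_sym u v : tensor_eq u v -> tensor_eq v u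
| tensor_trans u v w : tensor_eq u v -> tensor_eq v w -> tensor_eq u w
| tensor_cat u u' v v' :
    tensor_eq u u' -> tensor_eq v v' -> tensor_eq (u ++ v) (u' ++ v')
| tensor_comm u v : tensor_eq (u ++ v) (v ++ u)
| tensor_0l a : tensor_eq [:: (0, a)] [::]
| tensor_0r n : tensor_eq [:: (n, 0)] [::]
| tensor_Dl n n' a : tensor_eq [:: (n + n', a)] [:: (n, a); (n', a)]
| tensor_Dr n a a' : tensor_eq [:: (n, a + a')] [:: (n, a); (n, a')]
| tensor_Z r n a : tensor_eq [:: (r *: n, a)] [:: (n, r *: a)].

Definition tensor_map (N A B : lmodType R) (f : A -> B) (u : seq (N * A)) :
  seq (N * B) := [seq (p.1, f p.2) | p <- u].

Definition flat (N : lmodType R) : Prop :=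
  forall (A B : lmodType R) (f : {linear A -> B}), injective f ->
  forall u v : seq (N * A),
    tensor_eq (tensor_map f u) (tensor_map f v) -> tensor_eq u v.

End Flatness.

Section Overrings.
Variable R : idomainType.

Record overring := Overring {
  overring_set :> subringClosed {fraction R};
  overring_tofrac : forall r : R, r%:F \in overring_set
}.

Record overring_type (S : overring) := OverringElt {
  overring_val :> {fraction R};
  overring_valP : overring_val \in overring_set S
}.

HB.instance Definition _ (S : overring) := [isSub for @overring_val S].
HB.instance Definition _ (S : overring) := [Choice of overring_type S by <:].
HB.instance Definition _ (S : overring) :=
  [SubChoice_isSubComNzRing of overring_type S by <:].

Section OverringModule.
Variable S : overring.

Definition overring_scale (r : R) (x : overring_type S) : overring_type S :=
  OverringElt (rpredM (overring_tofrac S r) (overring_valP x)).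

Lemma overring_scaleA a b v :
  overring_scale a (overring_scale b v) = overring_scale (a * b) v.
Proof. by apply: val_inj; rewrite /= rmorphM mulrA. Qed.

Lemma overring_scale1 : left_id 1 overring_scale.
Proof. by move=> v; apply: val_inj; rewrite /= rmorph1 mul1r. Qed.

Lemma overring_scaleDr : right_distributive overring_scale +%R.
Proof. by move=> a u v; apply: val_inj; rewrite /= mulrDr. Qed.

Lemma overring_scaleDl v : {morph overring_scale^~ v : a b / a + b}.
Proof. by move=> a b; apply: val_inj; rewrite /= rmorphD mulrDl. Qed.

HB.instance Definition _ := GRing.Zmodule_isLmodule.Build R (overring_type S)
  overring_scaleA overring_scale1 overring_scaleDr overring_scaleDl.

End OverringModule.

Definition is_localization (S : overring) : Prop :=
  exists W : {pred R}, [/\ mulr_closed W, 0 \notin W &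
    forall x : {fraction R},
      x \in overring_set S <-> exists r w, w \in W /\ x = r%:F / w%:F].

Definition flat_overrings_are_localizations : Prop :=
  forall S : overring, flat (overring_type S) -> is_localization S.

End Overrings.

(* [idealr_closed] includes properness. *)
Definition maximal_ideal (T : comNzRingType) (M : {pred T}) : Prop :=
  idealr_closed M /\
  forall I : {pred T}, idealr_closed I -> {subset M <= I} -> {subset I <= M}.

Definition local_domain (T : idomainType) (M : {pred T}) : Prop :=
  maximal_ideal M /\ forall M' : {pred T}, maximal_ideal M' -> M' =i M.

Definition valuation_domain (T : idomainType) : Prop :=
  forall x : {fraction T}, x != 0 ->
    (exists t : T, x = t%:F) \/ (exists t : T, x^-1 = t%:F).

Section Pullback.
Variables (D T : idomainType) (pi : {rmorphism T -> {fraction D}}).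

Definition pullback_set : {pred T} :=
  [pred t | `[< exists d : D, pi t = d%:F >]].

Lemma pullback_setP t :
  reflect (exists d : D, pi t = d%:F) (t \in pullback_set).
Proof. exact: asboolP. Qed.

Lemma pullback_subring_closed : subring_closed pullback_set.
Proof.
split; first by apply/pullback_setP; exists 1; rewrite !rmorph1.
- move=> x y /pullback_setP[a Ha] /pullback_setP[b Hb].
  by apply/pullback_setP; exists (a - b); rewrite !rmorphB Ha Hb.
- move=> x y /pullback_setP[a Ha] /pullback_setP[b Hb].
  by apply/pullback_setP; exists (a * b); rewrite !rmorphM Ha Hb.
Qed.

HB.instance Definition _ :=
  GRing.isSubringClosed.Build T pullback_set pullback_subring_closed.

Record pullback := Pullback {
  pullback_val :> T;
  pullback_valP : pullback_val \in pullback_set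
}.

HB.instance Definition _ := [isSub for pullback_val].
HB.instance Definition _ := [Choice of pullback by <:].
HB.instance Definition _ := [SubChoice_isSubComNzRing of pullback by <:].

(* The predicate is not closed under inverse in T, so the units of the
   pullback are not inherited from T. *)
Definition pullback_unit : {pred pullback} :=
  [pred x | (val x \is a GRing.unit) && ((val x)^-1 \in pullback_set)].

Definition pullback_inv (x : pullback) : pullback :=
  if x \in pullback_unit then insubd x (val x)^-1 else x.

Lemma pullback_mulVx : {in pullback_unit, left_inverse 1 pullback_inv *%R}.
Proof.
move=> x xu; have /andP[xU xV] := xu.
apply: val_inj; rewrite /pullback_inv xu rmorphM rmorph1 /=.
by rewrite -!/(val _) insubdK // mulVr.
Qed.

Lemma pullback_unitPl x y : y * x = 1 -> pullback_unit x.
Proof.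
move=> /(congr1 val); rewrite rmorphM rmorph1 /= => yx1.
have xU : val x \is a GRing.unit.
  by apply/unitrP; exists (val y); split; rewrite // mulrC.
rewrite /pullback_unit /= xU /=.
by rewrite -[(val x)^-1]mul1r -yx1 mulrK //; apply: valP.
Qed.

Lemma pullback_inv_out : {in [predC pullback_unit], pullback_inv =1 id}.
Proof. by move=> x /negbTE xu; rewrite /pullback_inv xu. Qed.

HB.instance Definition _ := GRing.ComNzRing_hasMulInverse.Build pullback
  pullback_mulVx pullback_unitPl pullback_inv_out.

Lemma pullback_mulf_eq0 : GRing.integral_domain_axiom pullback.
Proof.
move=> x y /(congr1 val); rewrite rmorphM rmorph0 => /eqP.
by rewrite mulf_eq0 -!(inj_eq val_inj) !rmorph0.
Qed.

HB.instance Definition _ :=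
  GRing.ComUnitRing_isIntegral.Build pullback pullback_mulf_eq0.

End Pullback.

(* Main.v *)
(* Flatness is made elementary by Richman's criterion: an overring S of R is
   flat iff (R : s) S = S for every s in S. Likewise, S is a localization iff
   every s in S has a denominator w in R with 1/w in S. Let P be the pullback;
   then M = ker pi lies in P, and Frac P embeds in Frac T with T in its image.
   - For S over D, the criterion passes from S to pi^-1(S), because M lies in
     every conductor (P : s), and denominators are pushed forward along pi.
   - Let T be a valuation domain and S an overring of P. If S lies in T, then
     M lies in S, flatness passes to pi(S), and denominators lift because T is
     local. Otherwise some x in S has 1/x in M, and then 1/x, or 1/s when s is
     not in T, is a denominator of s: here S is a localization, flat or not. *)

From HB Require Import structures.
Require Import Defs.
From mathcomp Require Import all_boot all_algebra.
From mathcomp Require Import boolp ring.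

Set Implicit Arguments.
Unset Strict Implicit.
Unset Printing Implicit Defensive.

Import GRing.Theory.
Local Open Scope ring_scope.

(** * Fractions, and the copy of [R] inside its fraction field *)

Section Fractions.
Variable R : idomainType.
Implicit Type x : {fraction R}.

Lemma fracP x : exists a b : R, b != 0 /\ x = a%:F / b%:F.
Proof.
elim/quotW: x => r; exists (frac r).1, (frac r).2.
have d0 := denom_ratioP r; split=> //.
apply: (canRL (mulfK _)); first by rewrite tofrac_eq0.
rewrite /FracField.tofrac; unlock; rewrite -[LHS]FracField.pi_mul.
apply/eqmodP; rewrite /= FracField.equivfE /FracField.mulf.
by rewrite !numden_Ratio ?mulr1 ?oner_eq0 // mulrC.
Qed.

Definition from_ring : {pred {fraction R}} :=
  [pred x | `[< exists r : R, x = r%:F >]].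

Lemma from_ringP x : reflect (exists r : R, x = r%:F) (x \in from_ring).
Proof. exact: asboolP. Qed.

Lemma from_ring_tofrac r : r%:F \in from_ring.
Proof. by apply/from_ringP; exists r. Qed.

Lemma from_ring_subring_closed : subring_closed from_ring.
Proof.
split=> [|_ _ /from_ringP[a ->] /from_ringP[b ->]
         |_ _ /from_ringP[a ->] /from_ringP[b ->]]; apply/from_ringP.
- by exists 1; rewrite rmorph1.
- by exists (a - b); rewrite rmorphB.
- by exists (a * b); rewrite rmorphM.
Qed.

HB.instance Definition _ :=
  GRing.isSubringClosed.Build {fraction R} from_ring from_ring_subring_closed.

Lemma tofrac_inj : injective (fun r : R => r%:F).
Proof. by move=> a b /eqP; rewrite tofrac_eq => /eqP. Qed.

(* The value is 0 outside [from_ring]. *)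
Definition to_ring x : R :=
  if pselect (exists r : R, x = r%:F) is left ex then sval (cid ex) else 0.

Lemma to_ringK r : to_ring r%:F = r.
Proof.
rewrite /to_ring; case: pselect => [ex|[]]; last by exists r.
by case: cid => a /= /tofrac_inj.
Qed.

Lemma to_ringD x y : x \in from_ring -> y \in from_ring ->
  to_ring (x + y) = to_ring x + to_ring y.
Proof.
by move=> /from_ringP[a ->] /from_ringP[b ->]; rewrite -rmorphD !to_ringK.
Qed.

Lemma to_ringZ r x : x \in from_ring -> to_ring (r%:F * x) = r * to_ring x.
Proof. by move=> /from_ringP[a ->]; rewrite -rmorphM !to_ringK. Qed.

End Fractions.

Arguments from_ring {R}.

(** * Congruence of formal sums, and ideals on two generators *)

Section Tensor.
Variables (R : comNzRingType) (N A : lmodType R).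
Implicit Types u v : seq (N * A).

Lemma tensor_cons p u v : tensor_eq u v -> tensor_eq (p :: u) (p :: v).
Proof. exact: (tensor_cat (tensor_refl [:: p])). Qed.

Lemma tensor_catCA u v w : tensor_eq (u ++ (v ++ w)) (v ++ (u ++ w)).
Proof.
by rewrite !catA; apply: tensor_cat; [apply: tensor_comm | apply: tensor_refl].
Qed.

End Tensor.

Section Span2.
Variables (R : comNzRingType) (a b : R).

(** The ideal (a, b), taken inside [R^o] so that it becomes a module whose inclusion into [R^o] can
    test flatness. *)
Definition span2 : {pred R^o} :=
  [pred x | `[< exists c d : R, x = c * a + d * b >]].

Lemma span2P (x : R) :
  reflect (exists c d : R, x = c * a + d * b) (x \in span2).
Proof. exact: asboolP. Qed.

Lemma span2_submod_closed : submod_closed span2.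
Proof.
split=> [|r _ _ /span2P[c [d ->]] /span2P[c' [d' ->]]]; apply/span2P.
  by exists 0, 0; rewrite !mul0r addr0.
exists (r * c + c'), (r * d + d').
by rewrite /GRing.scale /= mulrDr !mulrA !mulrDl addrACA.
Qed.

HB.instance Definition _ :=
  GRing.isSubmodClosed.Build R R^o span2 span2_submod_closed.

Record span2_type := Span2 { span2_val :> R^o; span2_valP : span2_val \in span2 }.

HB.instance Definition _ := [isSub for span2_val].
HB.instance Definition _ := [Choice of span2_type by <:].
HB.instance Definition _ := [SubChoice_isSubLmodule of span2_type by <:].

End Span2.

(** * Richman's criterion for flat overrings *)

Section OverringFlatness.
Variables (R : idomainType) (S : overring R).
Implicit Types (x y s : {fraction R}) (J : {fraction R} -> Prop).

(** The S-submodules of Frac R. Testing against all of them avoids writing out the finite sums that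
    make up I S. *)
Definition overring_submodule J : Prop :=
  [/\ J 0, forall x y, J x -> J y -> J (x + y) &
      forall s x, s \in overring_set S -> J x -> J (s * x)].

(* [dense I] says that I S = S. *)
Definition dense (I : R -> Prop) : Prop :=
  forall J, overring_submodule J -> (forall r, I r -> J r%:F) -> J 1.

Definition conductor s (r : R) : Prop := r%:F * s \in from_ring.

Lemma dense_sub (I I' : R -> Prop) :
  dense I -> (forall r, I r -> I' r) -> dense I'.
Proof. by move=> dI sub J SJ I'J; apply: dI => // r /sub /I'J. Qed.

Lemma dense_true : dense (fun=> True).
Proof. by move=> J _ /(_ 1 Logic.I); rewrite rmorph1. Qed.

Definition mul_stable (I : R -> Prop) : Prop := forall a r, I r -> I (a * r).

(** By stability, products of elements of I and I' lie in both sets, and I I' S = I S = S. *)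
Lemma dense_and (I I' : R -> Prop) :
  dense I -> dense I' -> mul_stable I -> mul_stable I' ->
  dense (fun r => I r /\ I' r).
Proof.
move=> dI dI' sI sI' J SJ IJ; have [J0 JD JM] := SJ.
apply: dI' => // r' I'r'.
(* For fixed r' in I', the submodule (J : r') contains I, hence 1. *)
pose J' x := J (x * r'%:F).
suff : J' 1 by rewrite /J' mul1r.
apply: dI => [|r Ir]; last first.
  rewrite /J' -rmorphM; apply: IJ.
  by split; [rewrite mulrC; apply: sI | apply: sI'].
split=> [|x y Jx Jy|s x sS Jx]; rewrite /J'.
- by rewrite mul0r.
- by rewrite mulrDl; apply: JD.
- by rewrite -mulrA; apply: JM.
Qed.

Local Notation OS := (overring_type S).

Section Converse.
Hypothesis dense_conductor : forall s, s \in overring_set S -> dense (conductor s).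

Definition clears (A : lmodType R) (r : R) (u : seq (OS * A)) : bool :=
  all (fun p : OS * A => r%:F * val p.1 \in from_ring) u.

(** The product r u, read in A through the identification of R (x) A with A; it has this meaning
    when [clears r u] holds. *)
Definition cleared (A : lmodType R) (r : R) (u : seq (OS * A)) : A :=
  \sum_(p <- u) to_ring (r%:F * val p.1) *: p.2.

Lemma clears_mull (A : lmodType R) (u : seq (OS * A)) a r :
  clears r u -> clears (a * r) u.
Proof.
move=> /allP ru; apply/allP => p pu; rewrite rmorphM -mulrA.
by apply: rpredM; [apply: from_ring_tofrac | apply: ru].
Qed.

Lemma cleared_mull (A : lmodType R) (u : seq (OS * A)) a r :
  clears r u -> cleared (a * r) u = a *: cleared r u.
Proof.
move=> /allP ru; rewrite scaler_sumr; apply: eq_big_seq => p pu.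
by rewrite rmorphM -mulrA [X in X *: _ = _]to_ringZ ?ru // scalerA.
Qed.

(** Only finitely many conductors occur, and [dense_and] intersects them. *)
Lemma dense_clears (A : lmodType R) (u : seq (OS * A)) :
  dense (fun r => clears r u).
Proof.
elim: u => [|p u IH]; first exact: (dense_sub dense_true).
apply: (dense_sub (dense_and (dense_conductor (valP p.1)) IH _ _)).
- move=> a r rp; rewrite /conductor rmorphM -mulrA.
by apply: rpredM => //; apply: from_ring_tofrac.
- by move=> a r; apply: clears_mull.
- by move=> r [rp ru]; apply/andP.
Qed.

Arguments dense_clears {A} u.

Definition cleared_eq (A : lmodType R) (u v : seq (OS * A)) (r : R) : Prop :=
  [/\ clears r u, clears r v & cleared r u = cleared r v].

Lemma cleared_eq_stable (A : lmodType R) (u v : seq (OS * A)) :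
  mul_stable (cleared_eq u v).
Proof.
by move=> a r [ru rv uv]; split; rewrite ?clears_mull ?cleared_mull ?uv.
Qed.

(** Induction on the congruence: transitivity and concatenation intersect two dense sets, and each
    bilinearity relation becomes an identity in A as soon as r clears the coefficients involved. *)
Lemma tensor_eq_cleared (A : lmodType R) (u v : seq (OS * A)) :
  tensor_eq u v -> dense (cleared_eq u v).
Proof.
have cat r (s t : seq (OS * A)) : cleared r (s ++ t) = cleared r s + cleared r t.
  by rewrite /cleared big_cat.
elim=> {u v} [u|u v _ duv|u v w _ duv _ dvw|u u' v v' _ du _ dv|u v
             |a|n|n n' a|n a a'|r n a].
- by apply: (dense_sub (dense_clears u)).
- by apply: (dense_sub duv) => r [].
- apply: (dense_sub (dense_and duv dvw (@cleared_eq_stable A u v)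
    (@cleared_eq_stable A v w))).
  by move=> r [[ru rv uv] [_ rw vw]]; split=> //; rewrite uv.
- apply: (dense_sub (dense_and du dv (@cleared_eq_stable A u u')
    (@cleared_eq_stable A v v'))).
  move=> r [[ru ru' uu'] [rv rv' vv']].
  by split; rewrite ?cat ?uu' ?vv' // /clears all_cat; apply/andP.
- apply: (dense_sub (dense_clears (u ++ v))) => r ruv.
  split=> //; last by rewrite !cat addrC.
  by move: ruv; rewrite /clears !all_cat andbC.
- apply: (dense_sub dense_true) => r _; split=> //=.
    by rewrite mulr0 rpred0.
  by rewrite /cleared big_seq1 big_nil /= mulr0 -tofrac0 to_ringK scale0r.
- apply: (dense_sub (dense_clears [:: (n, 0 : A)])) => r rn; split=> //.
  by rewrite /cleared big_seq1 big_nil /= scaler0.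
- apply: (dense_sub (dense_clears [:: (n, a); (n', a)])) => r rn; split=> //.
    by move: rn => /and3P[/= rn rn' _]; rewrite /clears /= mulrDr rpredD.
  move: rn => /and3P[/= rn rn' _].
  by rewrite /cleared !big_cons !big_nil /= mulrDr to_ringD // scalerDl !addr0.
- apply: (dense_sub (dense_clears [:: (n, a)])) => s rn; split=> //.
    by move: rn => /andP[/= rn _]; rewrite /clears /= rn.
  by rewrite /cleared !big_cons !big_nil /= scalerDr !addr0.
- apply: (dense_sub (dense_clears [:: (n, a)])) => s /andP[/= sn _].
  have sE : s%:F * val (r *: n) = r%:F * (s%:F * val n) by rewrite /= mulrCA.
  split.
  + by rewrite /clears /= -/(val _) sE rpredM // from_ring_tofrac.
  + by rewrite /clears /= sn.
  + by rewrite /cleared !big_seq1 /= -/(val (r *: n)) sE to_ringZ // scalerA mulrC.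
Qed.

(** The action of S on S (x) A, at the level of formal sums. *)
Definition tensor_lscale (A : lmodType R) (s : OS) (u : seq (OS * A)) :=
  [seq (s * p.1, p.2) | p <- u].

Lemma tensor_lscale_eq (A : lmodType R) (s : OS) (u v : seq (OS * A)) :
  tensor_eq u v -> tensor_eq (tensor_lscale s u) (tensor_lscale s v).
Proof.
elim=> {u v} [u|u v _|u v w _ IH _|u u' v v' _ IH _|u v
             |a|n|n n' a|n a a'|r n a].
- exact: tensor_refl.
- exact: tensor_sym.
- exact: tensor_trans.
- by rewrite /tensor_lscale !map_cat; apply: tensor_cat.
- by rewrite /tensor_lscale !map_cat; apply: tensor_comm.
- by rewrite /= mulr0; apply: tensor_0l.
- exact: tensor_0r.
- by rewrite /= mulrDr; apply: tensor_Dl.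
- exact: tensor_Dr.
- suff -> : tensor_lscale s [:: (r *: n, a)] = [:: (r *: (s * n), a)].
    exact: tensor_Z.
  by congr [:: (_, _)]; apply: val_inj; rewrite /= mulrCA.
Qed.

Lemma tensor_lscale0 (A : lmodType R) (u : seq (OS * A)) :
  tensor_eq (tensor_lscale 0 u) [::].
Proof.
elim: u => [|p u IH] /=; first exact: tensor_refl.
rewrite mul0r -cat1s -[X in tensor_eq _ X]cats0.
by apply: tensor_cat => //; apply: tensor_0l.
Qed.

Lemma tensor_lscaleD (A : lmodType R) (s s' : OS) (u : seq (OS * A)) :
  tensor_eq (tensor_lscale (s + s') u) (tensor_lscale s u ++ tensor_lscale s' u).
Proof.
elim: u => [|p u IH] /=; first exact: tensor_refl.
rewrite mulrDl; apply: tensor_trans (tensor_cat (u := [:: _])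
  (tensor_Dl _ _ _) IH) _.
exact/tensor_cons/(tensor_catCA [:: _]).
Qed.

(** Each r n lies in R, so it crosses the tensor sign: r n (x) a = 1 (x) (r n) a. The second factors
    then add up. *)
Lemma tensor_lscale_cleared (A : lmodType R) (r : R) (u : seq (OS * A)) :
  clears r u -> tensor_eq (tensor_lscale (r *: (1 : OS)) u) [:: (1, cleared r u)].
Proof.
elim: u => [|p u IH] /=.
  by move=> _; rewrite /cleared big_nil; apply/tensor_sym/tensor_0r.
move=> /andP[/from_ringP[c cE] /IH{}IH].
rewrite /cleared big_cons; apply/tensor_sym/(tensor_trans (tensor_Dr _ _ _)).
apply: (tensor_cat (u := [:: _]) (u' := [:: _])); last exact: tensor_sym.
apply: tensor_trans (tensor_sym (tensor_Z _ _ _)) _.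
suff -> : to_ring (r%:F * val p.1) *: (1 : OS) = r *: (1 : OS) * p.1.
  exact: tensor_refl.
by apply: val_inj; rewrite /= mulr1 mulr1 cE to_ringK.
Qed.

(** If u and v agree after f, a dense set of r clears both images to the same element. Injectivity
    of f then gives r u = r v in S (x) A, and density leads from these r to 1. *)
Lemma dense_conductor_flat : flat (overring_type S).
Proof.
move=> A B f f_inj u v fuv.
have f_clears r (w : seq (OS * A)) : clears r (tensor_map f w) = clears r w.
  by rewrite /clears all_map.
have f_cleared r (w : seq (OS * A)) : cleared r (tensor_map f w) = f (cleared r w).
  rewrite /cleared big_map linear_sum; apply: eq_bigr => p _.
  by rewrite linearZ.
have clear_uv r : cleared_eq (tensor_map f u) (tensor_map f v) r -> 
    tensor_eq (tensor_lscale (r *: (1 : OS)) u) (tensor_lscale (r *: (1 : OS)) v).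
  rewrite /cleared_eq !f_clears !f_cleared => -[ru rv /f_inj uv].
  apply: tensor_trans (tensor_lscale_cleared ru) _; rewrite uv.
  exact/tensor_sym/tensor_lscale_cleared.
(* The s with s u = s v form an S-submodule; once it contains 1, u = v. *)
pose J x := exists2 s : OS,
  x = val s & tensor_eq (tensor_lscale s u) (tensor_lscale s v).
have [| |s s1 suv] := tensor_eq_cleared fuv (J := J).
- split.
  + exists 0 => //; apply: tensor_trans (tensor_lscale0 u) _.
    exact/tensor_sym/tensor_lscale0.
  + move=> _ _ [s -> suv] [s' -> suv']; exists (s + s') => //.
    apply: tensor_trans (tensor_lscaleD _ _ _) _.
    apply: tensor_trans (tensor_cat suv suv') _.
    exact/tensor_sym/tensor_lscaleD.
  + move=> s _ sS [s' -> suv]; exists (OverringElt sS * s') => //.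
    have lscaleM (w : seq (OS * A)) :
        tensor_lscale (OverringElt sS * s') w =
        tensor_lscale (OverringElt sS) (tensor_lscale s' w).
      by rewrite /tensor_lscale -map_comp; apply: eq_map => p /=; rewrite mulrA.
    by rewrite !lscaleM; apply: tensor_lscale_eq.
- move=> r /clear_uv ruv; exists (r *: (1 : OS)) => //.
  by rewrite /= mulr1.
- have sE : s = 1 by apply: val_inj; rewrite -s1.
  have lscale1 (w : seq (OS * A)) : tensor_lscale s w = w.
    rewrite sE /tensor_lscale -[RHS]map_id.
    by apply: eq_map => -[n a] /=; rewrite mul1r.
  by rewrite -(lscale1 u) -(lscale1 v).
Qed.

End Converse.

(* For s = a / b, flatness is applied to the inclusion of the ideal (a, b) into
   R, where 1 (x) a and s (x) b have the same image. The map sending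
   n (x) (c a + d b) to n c is well defined modulo (R : s) S, hence modulo J,
   and takes the values 1 and 0 on these two tensors. *)
Lemma flat_dense_conductor :
  flat (overring_type S) -> forall s, s \in overring_set S -> dense (conductor s).
Proof.
move=> flatS s sS J [J0 JD JM] IJ.
have JN x : J x -> J (- x).
  by move=> Jx; rewrite -mulN1r; apply: JM => //; rewrite rpredN rpred1.
have [a [b [b0 sE]]] := fracP s.
have in_span c d : c * a + d * b \in span2 a b by apply/span2P; exists c, d.
have coefP (x : span2_type a b) : exists c, exists d, val x = c * a + d * b.
  by apply/span2P; apply: valP.
(* An arbitrary choice of the coefficient of a; it need not be linear, but [coef_spec] makes it
   linear modulo J. *)
pose coef (x : span2_type a b) := sval (cid (coefP x)).
have coefE (x : span2_type a b) : exists d, val x = coef x * a + d * b.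
  by rewrite /coef; case: cid.
(* If (c - c') a = (d' - d) b, then (c - c') s = d' - d lies in R, so c - c' is in the conductor,
   which J contains. *)
have coef_spec c d (x : span2_type a b) :
    val x = c * a + d * b -> J ((coef x)%:F - c%:F).
  have [d' ->] := coefE x => E; rewrite -rmorphB; apply: IJ.
  rewrite /conductor sE mulrA -rmorphM; apply/from_ringP; exists (d - d').
  apply: (canLR (mulfK _)); rewrite ?tofrac_eq0 // -rmorphM; congr (_%:F).
  apply/eqP; rewrite -subr_eq0.
  rewrite (_ : _ - _ = coef x * a + d' * b - (c * a + d * b)); last by ring.
  by rewrite E subrr.
pose value (u : seq (OS * span2_type a b)) :=
  \sum_(p <- u) val p.1 * (coef p.2)%:F.
have valueP u v : tensor_eq u v -> J (value u - value v).
  elim=> {u v} [u|u v _ Juv|u v w _ Juv _ Jvw|u u' v v' _ Ju _ Jv|u v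
               |x|n|n n' x|n x x'|r n x].
  - by rewrite subrr.
  - by rewrite -opprB; apply: JN.
  - by rewrite -(subrKA (value v)); apply: JD.
  - by rewrite /value !big_cat opprD addrACA; apply: JD.
  - by rewrite /value !big_cat [X in X - _]addrC subrr.
  - by rewrite /value big_seq1 big_nil mul0r subrr.
  - rewrite /value big_seq1 big_nil subr0; apply: JM (valP n) _.
    rewrite -[_%:F]subr0 -tofrac0; apply: (coef_spec _ 0).
    by rewrite !mul0r addr0.
  - by rewrite /value !big_cons !big_nil !addr0 /= mulrDl subrr.
  - rewrite /value !big_cons !big_nil !addr0 /= -mulrDr -mulrBr.
    apply: JM (valP n) _; rewrite -rmorphD.
    have [[d xE] [d' xE']] := (coefE x, coefE x').
    by apply: (coef_spec _ (d + d')); rewrite /= -!/(val _) xE xE' !mulrDl addrACA.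
  - rewrite /value !big_seq1 /= -mulrA mulrCA -mulrBr.
    apply: JM (valP n) _; rewrite -rmorphM -opprB; apply: JN.
    have [d xE] := coefE x.
    apply: (coef_spec _ (r * d)).
    by rewrite /= -!/(val _) xE /GRing.scale /= mulrDr !mulrA.
pose ga := Span2 (in_span 1 0); pose gb := Span2 (in_span 0 1).
have span_val_inj : injective (val : span2_type a b -> R^o) by exact: val_inj.
have eq_gab : tensor_eq [:: (1 : OS, ga)] [:: (OverringElt sS, gb)].
  apply: (flatS _ R^o val span_val_inj) => /=.
  rewrite !mul1r !mul0r addr0 add0r.
  (* With the coefficients moved to the left, both sides become n (x) 1 with n = a = b s. *)
  have scaleE (n : OS) (c : R) : tensor_eq [:: (n, c : R^o)] [:: (c *: n, 1 : R^o)].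
    by apply: tensor_sym; rewrite -[X in tensor_eq _ [:: (_, X)]]mulr1; apply: tensor_Z.
  apply: tensor_trans (scaleE _ _) (tensor_trans _ (tensor_sym (scaleE _ _))).
  suff -> : a *: (1 : OS) = b *: OverringElt sS by apply: tensor_refl.
  by apply: val_inj; rewrite /= mulr1 sE mulrC divfK ?tofrac_eq0.
have := valueP _ _ eq_gab; rewrite /value !big_seq1 /= mul1r => Jab.
have Ja : J ((coef ga)%:F - 1) by rewrite -tofrac1; apply: (coef_spec _ 0).
have Jb : J (coef gb)%:F.
  by rewrite -[_%:F]subr0 -tofrac0; apply: (coef_spec _ 1).
(* All three pieces lie in J: the difference of the two values, [coef ga] - 1, and s times
   [coef gb]. *)
have -> : 1 = (coef ga)%:F - s * (coef gb)%:F - ((coef ga)%:F - 1)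
              + s * (coef gb)%:F.
  by ring.
by apply/JD/JM => //; apply/JD/JN.
Qed.

Lemma flat_overringP :
  flat (overring_type S) <-> forall s, s \in overring_set S -> dense (conductor s).
Proof. by split; [apply: flat_dense_conductor | apply: dense_conductor_flat]. Qed.

End OverringFlatness.

(** * Localizations described by denominators *)

Section Localization.
Variables (R : idomainType) (S : overring R).

(** For the converse, W is taken as large as possible: all nonzero w with 1/w in S. *)
Lemma is_localizationP :
  is_localization S <->
  forall s, s \in overring_set S ->
    exists w : R, [/\ w != 0, w%:F^-1 \in overring_set S & w%:F * s \in from_ring].
Proof.
split=> [[W [[W1 WM] W0 WP]] s|SP].
  have unitW w : w \in W -> w != 0.
    by move=> wW; apply: contraNneq W0 => <-.
  move=> /WP[r [w [wW ->]]]; exists w; split; first exact: unitW.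
    by apply/WP; exists 1, w; rewrite rmorph1 mul1r.
  rewrite mulrC divfK ?tofrac_eq0 ?unitW //; exact: from_ring_tofrac.
pose W : {pred R} := [pred w | (w != 0) && (w%:F^-1 \in overring_set S)].
exists W; split.
- split=> [|v w]; rewrite !inE; first by rewrite oner_eq0 rmorph1 invr1 rpred1.
  move=> /andP[v0 vS] /andP[w0 wS].
  by rewrite mulf_neq0 // rmorphM invfM rpredM.
- by rewrite inE eqxx.
- move=> x; split=> [/SP[w [w0 wS /from_ringP[r rE]]]|[r [w [/andP[w0 wS] ->]]]].
    exists r, w; split; first by rewrite inE w0.
    by rewrite -rE mulrC mulKf ?tofrac_eq0.
  by rewrite rpredM // overring_tofrac.
Qed.

End Localization.

(** * Extension of an injective morphism to the fraction field *)

Section FractionExtension.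
Variables (R : idomainType) (F : fieldType) (f : {rmorphism R -> F}).
Hypothesis f_inj : injective f.
Implicit Type x : {fraction R}.

(** Computed on an arbitrarily chosen numerator and denominator; [frac_extE] shows that the choice
    does not matter. *)
Definition frac_ext x : F :=
  f (sval (cid (fracP x))) / f (sval (cid (svalP (cid (fracP x))))).

Lemma frac_extE a b : b != 0 -> frac_ext (a%:F / b%:F) = f a / f b.
Proof.
have f0 c : c != 0 -> f c != 0 by rewrite -(inj_eq f_inj) rmorph0.
rewrite /frac_ext; case: cid => /= a' ex; case: cid => /= b' {ex} [b'0 E] b0.
apply/eqP; rewrite eqr_div ?f0 // -!rmorphM (inj_eq f_inj).
by rewrite -tofrac_eq !rmorphM -eqr_div ?tofrac_eq0 // E.
Qed.

Lemma frac_ext_tofrac r : frac_ext r%:F = f r.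
Proof. by rewrite -[r%:F]divr1 -tofrac1 frac_extE ?oner_eq0 // rmorph1 divr1. Qed.

Lemma frac_ext_is_zmod_morphism : zmod_morphism frac_ext.
Proof.
move=> x y; have [[a [b [b0 ->]]] [c [d [d0 ->]]]] := (fracP x, fracP y).
have f0 e : e != 0 -> f e != 0 by rewrite -(inj_eq f_inj) rmorph0.
rewrite -mulNr -rmorphN addf_div ?tofrac_eq0 // -!rmorphM -rmorphD.
rewrite !frac_extE ?mulf_neq0 // rmorphD !rmorphM rmorphN.
by rewrite -addf_div ?f0 // mulNr.
Qed.

Lemma frac_ext_is_monoid_morphism : monoid_morphism frac_ext.
Proof.
split=> [|x y]; first by rewrite -tofrac1 frac_ext_tofrac rmorph1.
have [[a [b [b0 ->]]] [c [d [d0 ->]]]] := (fracP x, fracP y).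
by rewrite mulf_div -!rmorphM !frac_extE ?mulf_neq0 // !rmorphM mulf_div.
Qed.

End FractionExtension.

(** * The pullback P and its fraction field inside Frac T *)

Section PullbackOverrings.
Variables (D T : idomainType) (pi : {rmorphism T -> {fraction D}}).
Local Notation P := (pullback pi).

Definition pullback_tofrac : P -> {fraction T} := @FracField.tofrac T \o val.

HB.instance Definition _ := GRing.RMorphism.on pullback_tofrac.

Lemma pullback_tofrac_inj : injective pullback_tofrac.
Proof. by move=> x y /tofrac_inj /val_inj. Qed.

Definition pullback_frac : {fraction P} -> {fraction T} :=
  frac_ext pullback_tofrac.

HB.instance Definition _ := GRing.isZmodMorphism.Build {fraction P} {fraction T}
  pullback_frac (frac_ext_is_zmod_morphism pullback_tofrac_inj).
HB.instance Definition _ := GRing.isMonoidMorphism.Build {fraction P} {fraction T}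
  pullback_frac (frac_ext_is_monoid_morphism pullback_tofrac_inj).

Lemma pullback_frac_tofrac (r : P) : pullback_frac r%:F = (val r)%:F.
Proof. by rewrite /pullback_frac frac_ext_tofrac //; apply: pullback_tofrac_inj. Qed.

Lemma pullback_frac_inj : injective pullback_frac.
Proof. exact: fmorph_inj. Qed.

(** P is the full preimage of D in T, so membership in P is read off residues. This carries
    conductors between P and D. *)
Lemma pullback_from_ring x t :
  pullback_frac x = t%:F -> (x \in from_ring) = (pi t \in from_ring).
Proof.
move=> xt; apply/from_ringP/from_ringP => [[r rE]|/pullback_setP tP].
  move: xt; rewrite rE pullback_frac_tofrac => /tofrac_inj <-.
  exact/pullback_setP/valP.
exists (Pullback tP); apply: pullback_frac_inj.
by rewrite xt pullback_frac_tofrac.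
Qed.

Lemma pullback_lift t : pi t \in from_ring -> exists r : P, val r = t.
Proof. by move=> /from_ringP /pullback_setP tP; exists (Pullback tP). Qed.

Lemma pi_from_ring (r : P) : pi (val r) \in from_ring.
Proof. by apply/from_ringP/pullback_setP/valP. Qed.

Hypothesis pi_surj : forall y, exists t, pi t = y.

(** Write pi t = d / e and lift e to t'. Then t' and t' t are in P, and t' is nonzero because e is,
    so t = (t' t) / t'. *)
Lemma pullback_frac_surj t : exists x, pullback_frac x = t%:F.
Proof.
have [d [e [e0 tE]]] := fracP (pi t); have [t' t'E] := pi_surj e%:F.
have [|r rE] := @pullback_lift t'; first by rewrite t'E from_ring_tofrac.
have [|r' r'E] := @pullback_lift (t' * t).
  by rewrite rmorphM tE t'E mulrC divfK ?tofrac_eq0 // from_ring_tofrac.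
exists (r'%:F / r%:F); rewrite fmorph_div /= !pullback_frac_tofrac rE r'E.
rewrite rmorphM mulrC mulKf // tofrac_eq0.
by apply: contraNneq e0 => t'0; rewrite -tofrac_eq0 -t'E t'0 rmorph0.
Qed.

(** * From an overring of D to its preimage under pi *)

Section Preimage.
Variable S : overring D.

(** This is pi^-1(S), transported into Frac P, where overrings of P live. *)
Definition preim_set : {pred {fraction P}} :=
  [pred x | `[< exists2 t, pullback_frac x = t%:F & pi t \in overring_set S >]].

Lemma preim_setP x :
  reflect (exists2 t, pullback_frac x = t%:F & pi t \in overring_set S)
          (x \in preim_set).
Proof. exact: asboolP. Qed.

Lemma preim_subring_closed : subring_closed preim_set.
Proof.
split=> [|x y /preim_setP[t xt tS] /preim_setP[u yu uS]
         |x y /preim_setP[t xt tS] /preim_setP[u yu uS]]; apply/preim_setP.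
- by exists 1; rewrite !rmorph1 ?rpred1.
- by exists (t - u); [rewrite !rmorphB /= xt yu | rewrite rmorphB rpredB].
- by exists (t * u); [rewrite !rmorphM /= xt yu | rewrite rmorphM rpredM].
Qed.

HB.instance Definition _ :=
  GRing.isSubringClosed.Build {fraction P} preim_set preim_subring_closed.

Lemma preim_tofrac (r : P) : r%:F \in preim_set.
Proof.
apply/preim_setP; exists (val r); first exact: pullback_frac_tofrac.
have /from_ringP[d ->] := pi_from_ring r; exact: overring_tofrac.
Qed.

Definition preim_overring : overring P := Overring preim_tofrac.

(** If J contains (P : s), then pi(J cap T) contains (D : pi t), hence 1. So some u in J has pi u =
    1, and 1 - u is in ker pi, which lies in (P : s) and so in J. *)
Lemma flat_preim : flat (overring_type S) -> flat (overring_type preim_overring).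
Proof.
move=> /flat_overringP flatS; apply/flat_overringP => s /preim_setP[t st tS].
move=> J [J0 JD JM] IJ.
pose J' y := exists x t, [/\ J x, pullback_frac x = t%:F & pi t = y].
have [||x [u [Jx xu u1]]] := flatS _ tS J'.
- split.
  + by exists 0, 0; rewrite !rmorph0.
  + move=> _ _ [x [u [Jx xu <-]]] [y [v [Jy yv <-]]].
    exists (x + y), (u + v); rewrite !rmorphD /= xu yv.
    by split=> //; apply: JD.
  + move=> s' _ s'S [x [u [Jx xu <-]]]; have [v vE] := pi_surj s'.
    have [y yv] := pullback_frac_surj v.
    exists (y * x), (v * u); rewrite !rmorphM /= yv xu vE; split=> //.
    by apply: JM => //; apply/preim_setP; exists v; rewrite ?vE.
- move=> d dt; have [u uE] := pi_surj d%:F.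
  have [|r rE] := @pullback_lift u; first by rewrite uE from_ring_tofrac.
  exists r%:F, u; rewrite pullback_frac_tofrac rE; split=> //; apply: IJ.
  rewrite /conductor (@pullback_from_ring _ (u * t)) ?rmorphM ?uE //.
  by rewrite /= pullback_frac_tofrac rE st.
have [|m mE] := @pullback_lift (1 - u).
  by rewrite rmorphB rmorph1 u1 subrr rpred0.
have -> : 1 = x + m%:F.
  apply: pullback_frac_inj.
  rewrite rmorphD rmorph1 /= pullback_frac_tofrac mE xu rmorphB rmorph1.
  by rewrite addrC subrK.
apply: JD => //; apply: IJ.
rewrite /conductor (@pullback_from_ring _ ((1 - u) * t)).
  by rewrite rmorphM rmorphB rmorph1 u1 subrr mul0r rpred0.
by rewrite [RHS]rmorphM rmorphM /= pullback_frac_tofrac mE st.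
Qed.

(** If w is a denominator of a lift of s, then d = pi w is one of s, with 1/d = pi(1/w) in S. *)
Lemma preim_localization : is_localization preim_overring -> is_localization S.
Proof.
move=> /is_localizationP locS; apply/is_localizationP => s sS.
have [t ts] := pi_surj s; have [x xt] := pullback_frac_surj t.
have [|w [w0 /preim_setP[t' wt' t'S] wx]] := locS x.
  by apply/preim_setP; exists t; rewrite ?ts.
have /from_ringP[d dE] := pi_from_ring w.
(* Here pi is applied to t' w = 1. This also gives d != 0, which does not follow from w != 0
   alone. *)
have td1 : pi t' * d%:F = 1.
  rewrite -dE -rmorphM -(rmorph1 pi); congr (pi _); apply: tofrac_inj.
  rewrite /= rmorphM /= -wt' -pullback_frac_tofrac -rmorphM mulVf ?tofrac_eq0 //.
  by rewrite !rmorph1.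
have d0 : d%:F != 0.
  by apply: contra_eq_neq td1 => ->; rewrite mulr0 eq_sym oner_eq0.
exists d; split; first by rewrite -tofrac_eq0.
  by rewrite -[_^-1]mul1r -td1 mulfK.
move: wx; rewrite (@pullback_from_ring _ (val w * t)) ?rmorphM ?dE ?ts //.
by rewrite /= pullback_frac_tofrac xt.
Qed.

End Preimage.

(** * From an overring of P to its image under pi *)

Section Image.
Variable S : overring P.

(** This is pi(S cap T), which is all of pi(S) once S lies in T. *)
Definition image_set : {pred {fraction D}} :=
  [pred y | `[< exists x t, [/\ x \in overring_set S, pullback_frac x = t%:F
                             & pi t = y] >]].

Lemma image_setP y :
  reflect (exists x t, [/\ x \in overring_set S, pullback_frac x = t%:F
                        & pi t = y])
          (y \in image_set).
Proof. exact: asboolP. Qed.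

Lemma image_subring_closed : subring_closed image_set.
Proof.
split=> [|_ _ /image_setP[x [t [xS xt <-]]] /image_setP[y [u [yS yu <-]]]
         |_ _ /image_setP[x [t [xS xt <-]]] /image_setP[y [u [yS yu <-]]]];
  apply/image_setP.
- by exists 1, 1; rewrite rpred1 !rmorph1.
- by exists (x - y), (t - u); rewrite rpredB // !rmorphB /= xt yu.
- by exists (x * y), (t * u); rewrite rpredM // !rmorphM /= xt yu.
Qed.

HB.instance Definition _ :=
  GRing.isSubringClosed.Build {fraction D} image_set image_subring_closed.

Lemma image_tofrac (d : D) : d%:F \in image_set.
Proof.
have [t tE] := pi_surj d%:F.
have [|r rE] := @pullback_lift t; first by rewrite tE from_ring_tofrac.
apply/image_setP; exists r%:F, t.
by rewrite overring_tofrac pullback_frac_tofrac rE.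
Qed.

Definition image_overring : overring D := Overring image_tofrac.

Hypothesis S_sub_T :
  forall x, x \in overring_set S -> exists t, pullback_frac x = t%:F.

(** If J contains (D : pi t), then pi^-1(J) contains (P : s), hence 1, and pi 1 = 1. *)
Lemma flat_image : flat (overring_type S) -> flat (overring_type image_overring).
Proof.
move=> /flat_overringP flatS.
apply/flat_overringP => _ /image_setP[s [t [sS st <-]]] J [J0 JD JM] IJ.
pose J' x := exists2 u, pullback_frac x = u%:F & J (pi u).
have [|r rs|u] := flatS _ sS J'.
- split.
  + by exists 0; rewrite ?rmorph0.
  + move=> x y [u xu Ju] [v yv Jv]; exists (u + v).
      by rewrite !rmorphD /= xu yv.
    by rewrite rmorphD; apply: JD.
  (* Multiplication by S stays inside T because S lies in T. *)
  + move=> x y xS [v yv Jv]; have [u xu] := S_sub_T xS.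
    exists (u * v); first by rewrite !rmorphM /= xu yv.
    by rewrite rmorphM; apply: JM => //; apply/image_setP; exists x, u.
- exists (val r); first exact: pullback_frac_tofrac.
  have /from_ringP[d dE] := pi_from_ring r; rewrite dE; apply: IJ.
  move: rs; rewrite /conductor (@pullback_from_ring _ (val r * t)).
    by rewrite rmorphM dE.
  by rewrite !rmorphM /= pullback_frac_tofrac st.
by rewrite rmorph1 -tofrac1 => /tofrac_inj <-; rewrite rmorph1.
Qed.

Hypothesis pi_neq0_unit : forall t, pi t != 0 -> t \is a GRing.unit.

(** Lift a denominator d of pi t to v in P. Then v is a unit of T, and 1/v differs from an element
    of S above 1/d by an element of ker pi, which lies in P and so in S. Moreover v t is in P since
    d pi t is in D. *)
Lemma image_localization : is_localization image_overring -> is_localization S.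
Proof.
move=> /is_localizationP locS; apply/is_localizationP => x xS.
have [t xt] := S_sub_T xS.
have [|d [d0 /image_setP[y [u [yS yu uE]]] dt]] := locS (pi t).
  by apply/image_setP; exists x, t.
have [v vE] := pi_surj d%:F.
have [|w wE] := @pullback_lift v; first by rewrite vE from_ring_tofrac.
have piv0 : pi v != 0 by rewrite vE tofrac_eq0.
have v0 : v != 0 by apply: contraNneq piv0 => ->; rewrite rmorph0.
have vU := pi_neq0_unit piv0.
exists w; split.
- by apply: contraNneq v0 => w0; rewrite -wE w0.
- have [|m mE] := @pullback_lift (v^-1 - u).
    by rewrite rmorphB rmorphV // vE uE subrr rpred0.
  suff -> : w%:F^-1 = y + m%:F by rewrite rpredD // overring_tofrac.
  apply: pullback_frac_inj.
  rewrite rmorphD fmorphV /= !pullback_frac_tofrac wE mE yu rmorphB rmorphV //.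
  by rewrite addrC subrK.
- rewrite (@pullback_from_ring _ (v * t)) ?rmorphM ?vE //.
  by rewrite /= pullback_frac_tofrac wE xt.
Qed.

End Image.

End PullbackOverrings.

(** * Valuation domains, and the two implications *)

Lemma valuation_maximal_ideal_unit (T : idomainType) (M : {pred T}) t :
  valuation_domain T -> maximal_ideal M -> t \notin M -> t \is a GRing.unit.
Proof.
move=> valT [[M0 M1 MD] maxM] tM.
(* The nonunits form a proper ideal containing M, so maximality puts every nonunit in M. *)
pose I : {pred T} := [pred x | x \isn't a GRing.unit].
have IE x : (x \in I) = (x \isn't a GRing.unit) by [].
apply: contraNT tM => tU; apply: (maxM I) => //; last first.
  move=> m mM; rewrite IE; apply: contra M1 => mU.
  by rewrite -(mulVr mU) -[_ * _]addr0; apply: MD.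
split; rewrite ?IE ?unitr0 ?unitr1 // => a u v; rewrite !IE => uI vI.
have [->|u0] := eqVneq u 0; first by rewrite mulr0 add0r.
have [->|v0] := eqVneq v 0; first by rewrite addr0 unitrM negb_and uI orbT.
(* One of u and v divides the other, so a u + v is a multiple of a nonunit. *)
have uv0 : u%:F / v%:F != 0 by rewrite mulf_neq0 ?invr_eq0 ?tofrac_eq0.
have [[c cE]|[c]] := valT _ uv0.
  have -> : u = c * v.
    by apply: tofrac_inj; rewrite /= rmorphM /= -cE divfK ?tofrac_eq0.
  by rewrite mulrA -[X in _ + X]mul1r -mulrDl unitrM negb_and vI orbT.
rewrite invf_div => cE; have -> : v = c * u.
  by apply: tofrac_inj; rewrite /= rmorphM /= -cE divfK ?tofrac_eq0.
by rewrite -mulrDl unitrM negb_and uI orbT.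
Qed.

Lemma overring_above_localization (D T : idomainType)
    (pi : {rmorphism T -> {fraction D}}) (S : overring (pullback pi)) x :
  valuation_domain T -> (forall t, pi t != 0 -> t \is a GRing.unit) ->
  x \in overring_set S -> (forall t, pullback_frac x != t%:F) ->
  is_localization S.
Proof.
move=> valT unitT xS xT.
(* For y outside T, the valuation property puts 1/y in T. It is not a unit there, so it lies in ker
   pi, hence in P. *)
have inverse y : (forall t, pullback_frac y != t%:F) ->
    exists w : pullback pi, [/\ w != 0, w%:F^-1 = y & pi (val w) = 0].
  move=> yT; have [|[u uE]|[u uE]] := valT (pullback_frac y).
  - by have := yT 0; rewrite rmorph0.
  - by have := yT u; rewrite uE eqxx.
  have piu : pi u = 0.
    apply/eqP; apply: contraT => /unitT uU; have := yT u^-1.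
    by rewrite rmorphV //= -uE invrK eqxx.
  have [|w wE] := @pullback_lift _ _ pi u; first by rewrite piu rpred0.
  have wy : w%:F^-1 = y.
    apply: pullback_frac_inj.
    by rewrite fmorphV /= pullback_frac_tofrac wE -uE invrK.
  exists w; rewrite wE; split=> //; apply: contraTneq (yT 0) => w0.
  by rewrite -wy w0 !rmorph0 invr0 rmorph0 eqxx.
apply/is_localizationP => s sS.
have [[t st]|sT] := pselect (exists t, pullback_frac s = t%:F).
  (* For s in T, w = 1/x works: w s is in ker pi, hence in P. *)
  have [w [w0 wx piw]] := inverse x xT; exists w; rewrite wx; split=> //.
  rewrite (@pullback_from_ring _ _ _ _ (val w * t)) ?rmorphM ?piw ?mul0r ?rpred0 //.
  by rewrite /= pullback_frac_tofrac st.
(* For s outside T, w = 1/s works, since w s = 1. *)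
have [|w [w0 ws _]] := inverse s.
  by move=> t; apply/eqP => st; apply: sT; exists t.
exists w; rewrite ws; split=> //.
by rewrite -ws divff ?tofrac_eq0 // rpred1.
Qed.

Theorem proposition3p3 (D T : idomainType) (M : {pred T})
    (T_local : local_domain M)
    (pi : {rmorphism T -> {fraction D}})
    (pi_surj : forall x : {fraction D}, exists t : T, pi t = x)
    (ker_pi : forall t : T, t \in M <-> pi t = 0) :
  (flat_overrings_are_localizations (pullback pi) ->
     flat_overrings_are_localizations D) /\
  (valuation_domain T -> flat_overrings_are_localizations D ->
     flat_overrings_are_localizations (pullback pi)).
Proof.
split=> [locP S flatS|valT locD S flatS].
  exact/(preim_localization pi_surj)/locP/flat_preim.
have unitT t : pi t != 0 -> t \is a GRing.unit.
  move=> pit; apply: valuation_maximal_ideal_unit valT T_local.1 _.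
  by apply: contraNN pit => /ker_pi ->.
(* If S lies in T, the hypothesis on D applies to pi(S); otherwise an element of S outside T
   supplies the denominators. *)
have [S_sub_T|] := pselect
  (forall x, x \in overring_set S -> exists t, pullback_frac x = t%:F).
  apply: (image_localization (pi_surj := pi_surj) S_sub_T unitT).
  exact/locD/flat_image.
move=> /existsNP[x /not_implyP[xS xT]].
apply: overring_above_localization valT unitT xS _.
by move=> t; apply/eqP => xt; apply: xT; exists t.
Qed.
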